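(* Let $n \ge 2m \ge 2$ and let $J(n,m)$ be the Johnson graph, with intersection numbers $c_i = i^2$ and $b_i=(m-i)(n-m-i)$ for $i=0,1,\ldots,m$. Let $A$ and $D$ be its adjacency matrix and distance matrix (same vertex ordering). Let $k_j=\binom{m}{j}\binom{n-m}{j}$ for $j=0,1,\ldots,m$ and $s=\sum_{j=0}^{m} j k_j$. Define $$p(x)=s\left\{ \prod_{i=1}^m\frac{x-b_{i}+i}{b_{0}-b_{i}+i}- \frac{1}{n-1} \prod_{\substack{i=0\\ i\neq1}}^m \frac{x-b_{i}+i}{b_{1}-b_{i}+i-1}\right\}.$$ Then $D=p(A)$.
   Context: The Johnson graph $J(n,m)$ has as vertices all $m$-element subsets of an $n$-element set, two vertices being adjacent if and only if they intersect in exactly $m-1$ elements. The distance matrix of a connected graph has $(u,v)$ entry equal to the length of a shortest $u$–$v$ path. The intersection numbers of a distance regular graph: for vertices $x,y$ at distance $i$, $c_i$ (resp. $b_i$) is the number of neighbours of $y$ at distance $i-1$ (resp. $i+1$) from $x$. *)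

(* Defs.v *)
From HB Require Import structures.
From mathcomp Require Import all_boot all_order all_algebra.
Set Implicit Arguments. Unset Strict Implicit. Unset Printing Implicit Defensive.
Import Order.TTheory GRing.Theory Num.Theory.
Local Open Scope ring_scope.

Definition jvert (n m : nat) := {S : {set 'I_n} | #|S| == m}.

Definition jadj (n m : nat) : rel (jvert n m) :=
  fun S T => #|val S :&: val T| == m.-1.

Fixpoint walk (T : finType) (e : rel T) (k : nat) (x y : T) : bool :=
  if k is k'.+1 then [exists z, e x z && walk e k' z y] else x == y.

(* Graph distance: least k with a walk of length k from x to y
   (searched in 0..#|T|-1; exact for connected graphs; #|T| if unreachable). *)
Definition gdist (T : finType) (e : rel T) (x y : T) : nat :=
  find (fun k => walk e k x y) (iota 0 #|T|).

Definition adj_mx (R : nzRingType) (T : finType) (e : rel T)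
  : 'M[R]_(#|{: T}|) :=
  \matrix_(i, j) (e (enum_val i) (enum_val j))%:R.

Definition dist_mx (R : nzRingType) (T : finType) (e : rel T)
  : 'M[R]_(#|{: T}|) :=
  \matrix_(i, j) (gdist e (enum_val i) (enum_val j))%:R.

Definition poly_mx (R : nzRingType) (N : nat) (p : {poly R}) (A : 'M[R]_N)
  : 'M[R]_N :=
  \sum_(i < size p) p`_i *: iter i (mulmx A) 1%:M.

Definition jb (n m i : nat) : nat := (m - i) * (n - m - i).

Definition jk (n m j : nat) : nat := 'C(m, j) * 'C(n - m, j).
Definition js (n m : nat) : nat := \sum_(0 <= j < m.+1) j * jk n m j.

Definition jpoly (R : fieldType) (n m : nat) : {poly R} :=
  let c i := (jb n m i)%:R - i%:R : R in
  (js n m)%:R *: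
   ( \prod_(1 <= i < m.+1) (('X - (c i)%:P) * (((jb n m 0)%:R - c i)^-1)%:P)
   - ((n%:R - 1)^-1)%:P *
     \prod_(0 <= i < m.+1 | i != 1%N)
        (('X - (c i)%:P) * (((jb n m 1)%:R - c i - 1)^-1)%:P)).

(* Main.v *)
(** Let B_j be the matrix with (S, T) entry 'C(|S :&: T|, j), and theta_i = b_i - i.
    Counting the neighbours of S as swaps of a point of S with a point outside S
    gives (A - theta_j) B_j = (m - j + 1)^2 B_{j-1}. Since B_m = 1, descending
    from m yields \prod_(k < i <= m) (A - theta_i) = ((m - k)!)^2 B_k, which
    evaluates both products in p(A) (k = 0 and k = 1) as combinations of B_0
    and B_1. Since d(S, T) = m - |S :&: T|, also D = m B_0 - B_1, and the
    coefficients are compared through s = m 'C(n - 1, m). *)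
Require Import Defs.
From HB Require Import structures.
From mathcomp Require Import all_boot all_order all_algebra.
From mathcomp Require Import zify ring.
Import Order.TTheory GRing.Theory Num.Theory.
Local Open Scope ring_scope.

Lemma prod_nat_neq1 (R : pzSemiRingType) (m : nat) (F : nat -> R) : (0 < m)%N ->
  \prod_(0 <= i < m.+1 | i != 1%N) F i = F 0%N * \prod_(2 <= i < m.+1) F i.
Proof.
move=> m0; rewrite big_ltn_cond // big_ltn_cond //=; congr (_ * _).
rewrite big_nat_cond [RHS]big_nat_cond; apply: eq_bigl => i.
by case: i => [|[|i]].
Qed.

(** * Evaluation of polynomials at a square matrix *)

Section PolyMx.
Variables (R : fieldType) (N : nat) (A : 'M[R]_N).

(** Coefficients beyond the size vanish, so polynomials of different sizes can be summed over one
    common range. *)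
Lemma poly_mx_wide (K : nat) (p : {poly R}) : (size p <= K)%N ->
  poly_mx p A = \sum_(i < K) p`_i *: iter i (mulmx A) 1%:M.
Proof.
move=> lepK; rewrite /poly_mx (big_ord_widen K (fun i => p`_i *: iter i (mulmx A) 1%:M) lepK).
rewrite big_mkcond /=.
apply: eq_bigr => i _; case: ltnP => // le; by rewrite nth_default // scale0r.
Qed.

Lemma poly_mxD (p q : {poly R}) : poly_mx (p + q) A = poly_mx p A + poly_mx q A.
Proof.
have sz := size_polyD p q.
rewrite (poly_mx_wide _ _ sz) (poly_mx_wide _ _ (leq_maxl (size p) (size q))).
rewrite (poly_mx_wide _ _ (leq_maxr (size p) (size q))) -big_split /=.
by apply: eq_bigr => i _; rewrite coefD scalerDl.
Qed.

Lemma poly_mxZ (c : R) (p : {poly R}) : poly_mx (c *: p) A = c *: poly_mx p A.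
Proof.
rewrite (poly_mx_wide _ _ (size_scale_leq c p)) /poly_mx scaler_sumr.
by apply: eq_bigr => i _; rewrite coefZ scalerA.
Qed.

Lemma poly_mx1 : poly_mx 1 A = 1%:M.
Proof. by rewrite /poly_mx size_poly1 big_ord1 coef1 scale1r. Qed.

Lemma poly_mxXM (p : {poly R}) : poly_mx ('X * p) A = A *m poly_mx p A.
Proof.
have sz : (size ('X * p)%R <= (size p).+1)%N.
  by apply: leq_trans (size_polyMleq _ _) _; rewrite size_polyX.
rewrite (poly_mx_wide _ _ sz) big_ord_recl coefXM scale0r add0r mulmx_sumr.
by apply: eq_bigr => i _; rewrite coefXM /= -scalemxAr.
Qed.

Lemma poly_mxXsubCM (c : R) (p : {poly R}) :
  poly_mx (('X - c%:P) * p) A = A *m poly_mx p A - c *: poly_mx p A.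
Proof.
by rewrite mulrBl mul_polyC -scaleNr poly_mxD poly_mxXM poly_mxZ scaleNr.
Qed.

End PolyMx.

(** * Swaps of points and sums over the neighbours of a vertex *)

Section Johnson.
Variables (n m : nat).

Local Notation V := (jvert n m).
Implicit Types (S T U : {set 'I_n}) (x y z : V).

Lemma card_jvert : #|{: V}| = 'C(n, m).
Proof. by rewrite card_sig -cardsE card_draws card_ord. Qed.

Lemma card_val x : #|val x| = m.
Proof. exact/eqP/(valP x). Qed.

Lemma card_valI x y : (#|val x :&: val y| <= m)%N.
Proof. by rewrite (leq_trans (subset_leq_card (subsetIl _ _))) ?card_val. Qed.

Lemma card_valI_eq x y : (m <= #|val x :&: val y|)%N = (x == y).
Proof.
apply/idP/eqP => [lemI|->]; last by rewrite setIid card_val.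
apply/val_inj/eqP; rewrite eqEcard !card_val leqnn andbT.
by apply/setIidPl/eqP; rewrite eqEcard subsetIl card_val.
Qed.

Definition swap S (ab : 'I_n * 'I_n) : {set 'I_n} := ab.2 |: (S :\ ab.1).

(** The subtraction never truncates: as [a \in S], a point [a] of [T] is counted in [S :&: T]. *)
Lemma card_swapI S T a b : a \in S -> b \notin S ->
  #|swap S (a, b) :&: T| = (#|S :&: T| - (a \in T) + (b \in T))%N.
Proof.
move=> aS bS.
have -> : (#|S :&: T| - (a \in T) = #|(S :\ a) :&: T|)%N.
  by rewrite (cardsD1 a (S :&: T)) inE aS /= addKn setIDAC.
rewrite /swap /= setIUl; case: (boolP (b \in T)) => bT.
  rewrite (_ : [set b] :&: T = [set b]); last by apply/setIidPl; rewrite sub1set.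
  by rewrite cardsU1 !inE (negbTE bS) andbF /= addnC.
rewrite (_ : [set b] :&: T = set0) ?set0U ?addn0 //.
by apply/setP => c; rewrite !inE; case: eqP => // ->; rewrite (negbTE bT).
Qed.

Lemma card_swap S a b : a \in S -> b \notin S -> #|swap S (a, b)| = #|S|.
Proof.
move=> aS bS; have := card_swapI S setT a b aS bS; rewrite !setIT !inE => ->.
by rewrite subnK // card_gt0; apply/set0Pn; exists a.
Qed.

Lemma swap_inj S :
  {in [pred ab | (ab.1 \in S) && (ab.2 \notin S)] &, injective (swap S)}.
Proof.
move=> [a b] [c d]; rewrite !inE /= => /andP[aS bS] /andP[cS dS] eqs.
(* The point [a] is absent from [swap S (a, b)], hence from [swap S (c, d)], which forces
   [a = c]. *)
have /setP/(_ a) := eqs; rewrite !inE aS eqxx /= andbT.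
have -> : a == b = false by apply: contraNF bS => /eqP <-.
have -> /= : a == d = false by apply: contraNF dS => /eqP <-.
move/esym/negbFE/eqP => eac.
have : b \in swap S (c, d) by rewrite -eqs !inE eqxx.
rewrite !inE (negbTE bS) andbF orbF /= => /eqP ->.
by rewrite eac.
Qed.

Hypothesis (m_gt0 : (0 < m)%N).

(** The differences [val x :\: S] and [S :\: val x] are singletons holding the two swapped
    points. *)
Lemma adj_swapP x S :
  reflect (exists2 ab, (ab.1 \in val x) && (ab.2 \notin val x) & S = swap (val x) ab)
          ((#|S| == m) && (#|val x :&: S| == m.-1)).
Proof.
apply: (iffP andP) => [[/eqP cS /eqP cI]|[[a b] /= /andP[ax bx] ->]].
  have /eqP/cards1P[a ea] : #|val x :\: S| = 1%N.
    by rewrite cardsD cI card_val; lia.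
  have /eqP/cards1P[b eb] : #|S :\: val x| = 1%N.
    by rewrite cardsD setIC cI cS; lia.
  have aP : a \in val x :\: S by rewrite ea set11.
  have bP : b \in S :\: val x by rewrite eb set11.
  move: aP bP; rewrite !inE => /andP[aS ax] /andP[bx bS].
  exists (a, b); first by rewrite /= ax bx.
  apply/setP => c; rewrite !inE /=.
  have /setP/(_ c) := ea; have /setP/(_ c) := eb; rewrite !inE => <- <-.
  by case: (c \in S); case: (c \in val x).
rewrite setIC card_swapI // setIid ax (negbTE bx) addn0 card_swap // card_val subn1.
by rewrite !eqxx.
Qed.

Lemma sum_adj (F : {set 'I_n} -> nat) x :
  (\sum_(z : V | jadj x z) F (val z) =
   \sum_(a in val x) \sum_(b in ~: val x) F (swap (val x) (a, b)))%N.
Proof.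
rewrite pair_big_dep /=.
pose P := [set ab : 'I_n * 'I_n | (ab.1 \in val x) && (ab.2 \notin val x)].
transitivity (\sum_(S in swap (val x) @: P) F S)%N; last first.
  rewrite big_imset /=; last first.
    by move=> u v; rewrite !inE => uP vP; apply: swap_inj; rewrite inE.
  by apply: eq_big => [[a b]|[a b] _] //; rewrite !inE.
(* [insub] is a partial inverse of [val], defined on every swap because a swap keeps the cardinality
   [m]. *)
rewrite (reindex_omap val (insub : {set 'I_n} -> option V)) /=; last first.
  move=> S /imsetP[[a b]]; rewrite inE /= => /andP[ax bx] ->.
  by rewrite insubT ?card_swap ?card_val.
apply: eq_bigl => z; rewrite valK eqxx andbT /jadj.
have -> : (#|val x :&: val z| == m.-1) = (#|val z| == m) && (#|val x :&: val z| == m.-1).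
  by rewrite (valP z).
apply/adj_swapP/imsetP => [[ab abP e]|[ab abP e]]; exists ab => //;
  by move: abP; rewrite inE.
Qed.

(** With i the size of [S :&: T], splitting by membership in [T] gives i C(i-1, j) + (m-i) C(i, j),
    and i C(i-1, j) = (i-j) C(i, j). If i < j, the difference truncates but the binomial is zero. *)
Lemma sum_bin_remove S T j : #|S| = m ->
  (\sum_(a in S) 'C(#|S :&: T| - (a \in T), j) = (m - j) * 'C(#|S :&: T|, j))%N.
Proof.
move=> cS; rewrite (bigID (mem T)) /=.
rewrite (eq_bigr (fun=> 'C((#|S :&: T|).-1, j))); last first.
  by move=> a /andP[_ ->]; rewrite subn1.
rewrite [X in (_ + X)%N](eq_bigr (fun=> 'C(#|S :&: T|, j))); last first.
  by move=> a /andP[_ /negbTE->]; rewrite subn0.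
rewrite !sum_nat_const.
have -> : #|[pred a | (a \in S) && (a \in T)]| = #|S :&: T|.
  by apply: eq_card => a; rewrite !inE.
have -> : #|[pred a | (a \in S) && (a \notin T)]| = (m - #|S :&: T|)%N.
  by rewrite -cS -cardsD; apply: eq_card => a; rewrite !inE andbC.
have := subset_leq_card (subsetIl S T); rewrite cS.
rewrite mul_bin_down -mulnDl; have [lt _|le le'] := ltnP #|S :&: T| j.
  by rewrite bin_small ?muln0.
by congr (_ * _)%N; lia.
Qed.

(** For a fixed removed point, Pascal's rule yields an extra C(k, j) for each inserted point lying
    in [val y]; the number of these is [m] minus the size of the intersection. [sum_bin_remove] then
    sums over the removed point. *)
Lemma sum_bin_adj x y j :
  (\sum_(z : V | jadj x z) 'C(#|val z :&: val y|, j.+1) =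
   (n - m) * (m - j.+1) * 'C(#|val x :&: val y|, j.+1) +
   (m - #|val x :&: val y|) * (m - j) * 'C(#|val x :&: val y|, j))%N.
Proof.
rewrite (sum_adj (fun S => 'C(#|S :&: val y|, j.+1))).
set i := #|_ :&: _|.
have H a : a \in val x ->
  (\sum_(b in ~: val x) 'C(#|swap (val x) (a, b) :&: val y|, j.+1) =
   (n - m) * 'C(i - (a \in val y), j.+1) + (m - i) * 'C(i - (a \in val y), j))%N.
  move=> ax; set k := (i - _)%N.
  rewrite (eq_bigr (fun b => 'C(k, j.+1) + (b \in val y) * 'C(k, j)))%N; last first.
    move=> b; rewrite inE => bx; rewrite card_swapI // -/i -/k.
    by case: (b \in val y); rewrite ?addn0 // addn1 binS mul1n.
  rewrite big_split /= sum_nat_const -big_distrl /=; congr (_ * _ + _ * _)%N.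
    by rewrite cardsCs setCK card_ord card_val.
  rewrite -big_mkcondr /=.
  have <- : #|val y :\: val x| = (m - i)%N by rewrite cardsD card_val setIC.
  by rewrite -sum1_card; apply: eq_bigl => b; rewrite !inE.
rewrite (eq_bigr _ H) big_split /= -!big_distrr /= !sum_bin_remove ?card_val //.
by rewrite !mulnA.
Qed.

(** The negative part of b_{j+1} - (j+1) stands on the left, which keeps the identity within the
    natural numbers. *)
Lemma sum_bin_adjE x y j : (j < m)%N -> (2 * m <= n)%N ->
  (\sum_(z : V | jadj x z) 'C(#|val z :&: val y|, j.+1) +
     j.+1 * 'C(#|val x :&: val y|, j.+1) =
   jb n m j.+1 * 'C(#|val x :&: val y|, j.+1) +
   (m - j) ^ 2 * 'C(#|val x :&: val y|, j))%N.
Proof.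
move=> ltjm lemn; rewrite sum_bin_adj.
have := card_valI x y.
set i := #|_ :&: _| => leim.
have E : ((m - i) * 'C(i, j) + j.+1 * 'C(i, j.+1) = (m - j) * 'C(i, j))%N.
  rewrite mul_bin_left -mulnDl; have [lt|le] := ltnP i j.
    by rewrite bin_small ?muln0.
  by congr (_ * _)%N; lia.
have -> : ((m - j) ^ 2 * 'C(i, j) = (m - j) * ((m - i) * 'C(i, j) + j.+1 * 'C(i, j.+1)))%N.
  by rewrite E mulnA.
rewrite /jb.
(* Writing [m] and [n - m] as [j.+1] plus a remainder removes the truncated subtractions before
   [ring]. *)
have [p ep] : {p | m = (j.+1 + p)%N} by exists (m - j.+1)%N; lia.
have [q eq] : {q | (n - m)%N = (j.+1 + q)%N} by exists (n - m - j.+1)%N; lia.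
rewrite eq; set d := (m - i)%N; have -> : (m - j = p.+1)%N by lia.
have -> : (m - j.+1 = p)%N by lia.
have -> : (j.+1 + q - j.+1 = q)%N by lia.
by ring.
Qed.

(** * Distances in the Johnson graph and their weighted sum *)

Lemma walk_card k x y : walk (@jadj n m) k x y -> (m - #|val x :&: val y| <= k)%N.
Proof.
elim: k x => [|k IH] x /=; first by move/eqP->; rewrite setIid card_val subnn.
case/existsP => z /andP[adj /IH].
have /adj_swapP[[a b] /= /andP[ax bx] ez] : (#|val z| == m) && (#|val x :&: val z| == m.-1).
  by rewrite card_val eqxx.
by rewrite ez card_swapI //; case: (b \in _); case: (a \in _) => /=; lia.
Qed.

(** Swapping a point of [val x :\: val y] for a point of [val y :\: val x] enlarges the intersection
    by one. *)
Lemma walk_exists k x y : (m - #|val x :&: val y| = k)%N -> walk (@jadj n m) k x y.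
Proof.
elim: k x => [|k IH] x eqk /=.
  by rewrite -card_valI_eq -subn_eq0 eqk.
have := cardsD (val x) (val y); have := cardsD (val y) (val x).
rewrite [val y :&: val x]setIC !card_val eqk => cy cx.
have /set0Pn[a] : val x :\: val y != set0 by rewrite -card_gt0 cx.
have /set0Pn[b] : val y :\: val x != set0 by rewrite -card_gt0 cy.
rewrite !inE => /andP[bx yb] /andP[ay ax].
have cz : #|swap (val x) (a, b)| == m by rewrite card_swap // card_val.
apply/existsP; exists (Sub (swap (val x) (a, b)) cz); apply/andP; split.
  have /andP[] // : (#|swap (val x) (a, b)| == m) && (#|val x :&: swap (val x) (a, b)| == m.-1).
  by apply/adj_swapP; exists (a, b); rewrite //= ax.
by apply: IH; rewrite SubK card_swapI // (negbTE ay) yb; lia.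
Qed.

Lemma gdist_jadj x y : (2 * m <= n)%N ->
  gdist (@jadj n m) x y = (m - #|val x :&: val y|)%N.
Proof.
move=> lemn; set d := (m - _)%N; rewrite /gdist.
set w := fun k => walk _ k x y.
(* The search in [gdist] covers only lengths below the number of vertices; here d <= m < C(m+1, m)
   <= C(n, m). *)
have ltd : (d < #|{: V}|)%N.
  rewrite card_jvert; apply: (@leq_trans 'C(m.+1, m)); first by rewrite binSn /d; lia.
  by apply: leq_bin2l; lia.
apply/eqP; rewrite eqn_leq; apply/andP; split.
  rewrite leqNgt; apply/negP => lt; have := before_find 0%N lt.
  by rewrite nth_iota // add0n /w walk_exists.
apply: walk_card; rewrite -/w.
have hw : has w (iota 0 #|{: V}|).
  by apply/hasP; exists d; [rewrite mem_iota | apply: walk_exists].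
have := nth_find 0%N hw; rewrite nth_iota ?add0n //.
by rewrite has_find size_iota in hw.
Qed.

(** Since j C(m, j) = m C(m-1, j-1) = m C(m-1, m-j) for j > 0, this is Vandermonde's convolution for
    n - 1 = (m - 1) + (n - m). *)
Lemma js_bin : (2 * m <= n)%N -> js n m = (m * 'C(n.-1, m))%N.
Proof.
move=> lemn; have [p ep] : {p | m = p.+1} by exists m.-1; lia.
have -> : n.-1 = (m.-1 + (n - m))%N by lia.
rewrite addnC -binomial.Vandermonde big_distrr /= /js big_mkord.
apply: eq_bigr => -[[|j] ltj] _; first by rewrite subn0 (@bin_small m.-1) ?muln0 //; lia.
rewrite /jk /= mulnA; move: ltj; rewrite ep /= => ltj.
by rewrite -mul_bin_diag /= subSS bin_sub // -mulnA; congr (_ * _)%N; rewrite mulnC.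
Qed.

(** * The matrices B_j and the action of A on them *)

Variable R : numFieldType.

Local Notation A := (adj_mx R (@jadj n m)).

Definition bin_mx (j : nat) : 'M[R]_(#|{: V}|) :=
  \matrix_(s, t) ('C(#|val (enum_val s : V) :&: val (enum_val t : V)|, j))%:R.

(** The eigenvalues of the Johnson graph. As theta_0 = b_0 and theta_1 = b_1 - 1, the denominators
    in p(x) are theta_0 - theta_i and theta_1 - theta_i. *)
Definition theta (i : nat) : R := (jb n m i)%:R - i%:R.

Hypothesis (le2mn : (2 * m <= n)%N).

Lemma adj_bin_mx j : (j < m)%N ->
  A *m bin_mx j.+1 = theta j.+1 *: bin_mx j.+1 + ((m - j) ^ 2)%:R *: bin_mx j.
Proof.
move=> ltjm; apply/matrixP => s t; rewrite !mxE.
set x : V := enum_val s; set y : V := enum_val t.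
transitivity ((\sum_(z : V | jadj x z) 'C(#|val z :&: val y|, j.+1))%:R : R).
  rewrite natr_sum [RHS]big_mkcond [RHS](reindex_onto enum_val enum_rank) /=; last first.
    by move=> z _; apply: enum_rankK.
  rewrite [RHS](eq_bigl xpredT); last by move=> u; rewrite enum_valK eqxx.
  apply: eq_bigr => u _; rewrite !mxE -/x -/y.
  by case: jadj; rewrite ?mul1r ?mul0r.
have /(congr1 (fun k => k%:R : R)) := sum_bin_adjE x y j ltjm le2mn.
rewrite /jb /theta !(natrD, natrM) => /(canRL (addrK _)) ->.
by ring.
Qed.

Lemma bin_mx_id : bin_mx m = 1%:M.
Proof.
apply/matrixP => s t; rewrite !mxE -(inj_eq enum_val_inj) -card_valI_eq.
case: leqP => [leI|ltI]; last by rewrite bin_small.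
by rewrite (_ : #|_| = m) ?binn //; apply/eqP; rewrite eqn_leq card_valI.
Qed.

Lemma poly_mx_prod k : (k <= m)%N ->
  poly_mx (\prod_(k.+1 <= i < m.+1) ('X - (theta i)%:P)) A =
  ((m - k)`! ^ 2)%:R *: bin_mx k.
Proof.
(* Descending induction on [k], starting at [k = m] with the empty product. *)
move ed: (m - k)%N => d; elim: d k ed => [|d IH] k ed lekm.
  have -> : k = m by lia.
  by rewrite big_geq // poly_mx1 bin_mx_id scale1r.
have lt : (k < m)%N by lia.
rewrite big_ltn // poly_mxXsubCM IH; [|lia|by []].
rewrite -scalemxAr adj_bin_mx // ed !scalerDr !scalerA.
by rewrite mulrC addrC addKr factS expnMn natrM mulrC.
Qed.

Lemma dist_mx_bin : dist_mx R (@jadj n m) = m%:R *: bin_mx 0 - bin_mx 1.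
Proof.
apply/matrixP => s t; rewrite !mxE gdist_jadj // bin0 bin1 mulr1 natrB //.
exact: card_valI.
Qed.

(** * Closed forms of the denominators *)

Lemma theta0B i : (i <= m)%N -> (jb n m 0)%:R - theta i = (i * (n.+1 - i))%:R.
Proof.
move=> leim; rewrite /theta opprB addrA; apply: (canLR (addrK _)).
rewrite -!natrD /jb !subn0; congr _%:R.
have [p ep] : {p | m = (i + p)%N} by exists (m - i)%N; lia.
have [q eq] : {q | (n - m)%N = (i + q)%N} by exists (n - m - i)%N; lia.
have -> : (n.+1 - i = p + (i + q).+1)%N by lia.
have -> : (m - i = p)%N by lia.
have -> : (n - m - i = q)%N by lia.
by rewrite eq ep; ring.
Qed.

(** Subtracting two cases of [theta0B] gives i(n+1-i) - n, which factors. *)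
Lemma theta1B i : (0 < i <= m)%N ->
  (jb n m 1)%:R - theta i - 1 = (i.-1 * (n - i))%:R.
Proof.
move=> /andP[i0 leim].
have := theta0B i leim; have := theta0B 1 m_gt0; rewrite mul1n subn1 /= => e1 ei.
transitivity ((i * (n.+1 - i))%:R - n%:R : R).
  by rewrite -e1 -ei /theta; ring.
apply: (canLR (addrK _)); rewrite -natrD; congr _%:R.
have [p ep] : {p | i = p.+1} by exists i.-1; lia.
have [q eq] : {q | n = (p.+1 + q)%N} by exists (n - i)%N; lia.
rewrite ep eq /= addKn; have -> : ((p.+1 + q).+1 - p.+1 = q.+1)%N by lia.
by ring.
Qed.

(** The factors i give m!, and the factors n+1-i give the falling factorial of length m, that is
    C(n, m) m!. *)
Lemma prod_theta0B :
  \prod_(1 <= i < m.+1) ((jb n m 0)%:R - theta i) = (m`! ^ 2 * 'C(n, m))%:R :> R.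
Proof.
rewrite (eq_big_nat _ _ (F2 := fun i => (i * (n.+1 - i))%:R)); last first.
  by move=> i /andP[_ lei]; rewrite theta0B.
rewrite -natr_prod big_split /= -fact_prod big_add1 big_mkord.
rewrite (eq_bigr (fun i : 'I_m => n - i)%N) // -ffact_prod -bin_ffact.
by congr _%:R; ring.
Qed.

Lemma prod_theta1B :
  \prod_(2 <= i < m.+1) ((jb n m 1)%:R - theta i - 1) =
  ((m - 1)`! ^ 2 * 'C(n - 2, m - 1))%:R :> R.
Proof.
rewrite (eq_big_nat _ _ (F2 := fun i => (i.-1 * (n - i))%:R)); last first.
  by move=> i iP; rewrite theta1B //; lia.
rewrite -natr_prod big_split /= big_add1 /= -{1}(prednK m_gt0) -fact_prod.
rewrite big_add1 big_add1 big_mkord (eq_bigr (fun i : 'I_m.-1 => n - 2 - i)%N); last first.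
  by move=> i _; rewrite -subnDA.
by rewrite -ffact_prod -bin_ffact -subn1; congr _%:R; ring.
Qed.

Lemma prod_XsubC_divC (I : eqType) (r : seq I) (P : pred I) (c d : I -> R) :
  \prod_(i <- r | P i) (('X - (c i)%:P) * ((d i)^-1)%:P) =
  (\prod_(i <- r | P i) d i)^-1 *: \prod_(i <- r | P i) ('X - (c i)%:P).
Proof.
by rewrite big_split /= -rmorph_prod prodfV mulrC mul_polyC.
Qed.

End Johnson.

Theorem theorem3p1 (R : numFieldType) (n m : nat) (hm : (1 <= m)%N) (hnm : (2 * m <= n)%N) :
  dist_mx R (@jadj n m) = poly_mx (jpoly R n m) (adj_mx R (@jadj n m)).
Proof.
rewrite dist_mx_bin // /jpoly !prod_XsubC_divC !prod_nat_neq1 //.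
rewrite prod_theta0B // prod_theta1B // js_bin //.
rewrite mul_polyC -scaleNr poly_mxZ poly_mxD !poly_mxZ poly_mxXsubCM.
(* The index 0 factor of the second product is still to be applied to B_1; [adj_bin_mx] turns A B_1
   into a combination of B_1 and B_0. *)
rewrite !(@poly_mx_prod _ _ hm) // -scalemxAr (@adj_bin_mx _ _ hm) // !subn0 subr0.
have th1 : theta n m R 1 = (jb n m 0)%:R - n%:R.
  by have := theta0B n m hm R hnm 1 hm; rewrite mul1n subn1 => <-; rewrite subKr.
have -> : (jb n m 1)%:R = theta n m R 1 + 1 by rewrite /theta subrK.
rewrite {}th1; set e := 'C(n - 2, m - 1); set c := 'C(n, m); set f := ((m - 1)`!).
(* This form of s absorbs the factor 1/(n-1) of p(x); [cE] then ties [e] to [c], so that [e] can be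
   eliminated. *)
have sE : (m * 'C(n.-1, m) = (n - 1) * e)%N.
  have [p ep] : {p | m = p.+1} by exists m.-1; lia.
  have [q eq] : {q | n = q.+2} by exists (n - 2)%N; lia.
  by rewrite /e eq ep !subSS !subn0 -mul_bin_diag.
have cE : (n * ((n - 1) * e) = m * (n - m) * c)%N.
  by rewrite -sE mulnCA mul_bin_down mulnA.
have gE : (m`! = m * f)%N by rewrite /f; case: (m) hm => // k _; rewrite subn1 factS.
(* Only differences of eigenvalues matter, so b_0 can be treated as arbitrary. *)
move: (jb n m 0) => b.
have nz k : (0 < k)%N -> k%:R != 0 :> R by rewrite pnatr_eq0 -lt0n.
have n0 : n%:R != 0 :> R by apply: nz; lia.
have m0 : m%:R != 0 :> R by apply: nz.
have f0 : f%:R != 0 :> R by apply: nz; apply: fact_gt0.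
have c0 : c%:R != 0 :> R by apply: nz; rewrite bin_gt0; lia.
have : (n - 1)%:R != 0 :> R by apply: nz; lia.
have : (n - m)%:R != 0 :> R by apply: nz; lia.
rewrite sE gE; move/(congr1 (fun k => k%:R : R)): cE.
rewrite !natrM !natrB; try lia.
move=> cE nm0 n10; apply/matrixP => s t; rewrite !mxE.
have -> : e%:R = m%:R * (n%:R - m%:R) * c%:R / (n%:R * (n%:R - 1)) :> R.
  by rewrite -cE; field; apply/andP.
(* The last side condition concerns the index 0 denominator theta_1 - theta_0 = -n. *)
field; rewrite n10 n0 c0 nm0 m0 f0 (_ : b%:R - _ + 1 - _ - 1 = - n%:R) ?oppr_eq0 //.
by ring.
Qed.
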